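(* Let $d\ge1$ and let $X,X'$ be $d$-dimensional random vectors such that $(X,X')$ is an exchangeable pair (i.e. $(X,X')$ and $(X',X)$ have the same joint distribution). Let $D=X-X'$ and suppose that $$\mathbb E[D\mid X]=\lambda\Lambda X+\lambda R$$ for some $0<\lambda<1$, some invertible $d\times d$ matrix $\Lambda$ and some random vector $R$. Let $\ell=e_1^t\Lambda^{-1}$ be the first row of $\Lambda^{-1}$, let $X_1$ and $D_1$ denote the first components of $X$ and $D$, and let $Z$ be a standard normal random variable. Then $$d_K(X_1,Z)\le \mathbb E\Big[\Big|1-\frac{1}{2\lambda}\mathbb E[\ell D\,D_1\mid X]\Big|\Big]+\frac1\lambda\mathbb E\Big[\big|\mathbb E[|\ell D|\,D_1\mid X]\big|\Big]+\frac{\sqrt{2\pi}}{4}\mathbb E[|\ell R|],$$ where $\ell D$ and $\ell R$ denote the Euclidean scalar products of $\ell$ (as a vector) with $D$ and $R$.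
   Context: $d_K(X,Y)=\sup_{z\in\mathbb R}|\mathbb P(X\le z)-\mathbb P(Y\le z)|$ denotes the Kolmogorov distance. *)

(* Defs.v *)
From HB Require Import structures.
From mathcomp Require Import all_boot all_order all_algebra.
From mathcomp Require Import all_classical all_reals all_analysis.

Set Implicit Arguments.
Unset Strict Implicit.
Unset Printing Implicit Defensive.

Import Order.TTheory GRing.Theory Num.Theory.
Local Open Scope classical_set_scope.
Local Open Scope ring_scope.

(* A d-dimensional random vector is given by its components X i : T -> R,
   i : 'I_d.  [vec_of X t] is the value of the vector at t, an element of
   d.-tuple R, which carries the product (Borel) sigma-algebra. *)
Definition vec_of {R : realType} {T : Type} (d : nat) (X : 'I_d -> T -> R)
  (t : T) : d.-tuple R := [tuple X i t | i < d].

Definition sigma_of {R : realType} {T : Type} (d : nat) (X : 'I_d -> T -> R)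
  : set (set T) := g_sigma_preimage X.

Definition exchangeable_pair {dT : measure_display} {T : measurableType dT}
  {R : realType} (P : probability T R) (d : nat) (X X' : 'I_d -> T -> R) :=
  forall B : set (d.-tuple R * d.-tuple R), measurable B ->
    P ((fun t => (vec_of X t, vec_of X' t)) @^-1` B) =
    P ((fun t => (vec_of X' t, vec_of X t)) @^-1` B).

Definition cond_exp_version {dT : measure_display} {T : measurableType dT}
  {R : realType} (P : probability T R) (G : set (set T)) (Y W : T -> R) :=
  [/\ P.-integrable setT (EFin \o Y),
      P.-integrable setT (EFin \o W),
      (forall B : set R, measurable B -> G (W @^-1` B)) &
      (forall A, G A -> (\int[P]_(x in A) (Y x)%:E = \int[P]_(x in A) (W x)%:E)%E)].

Definition kolmogorov_dist {R : realType} (F G : R -> \bar R) : \bar R :=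
  ereal_sup [set (`|F z - G z|)%E | z in [set: R]].

Definition distr_fun {dT : measure_display} {T : measurableType dT}
  {R : realType} (P : probability T R) (Y : T -> R) : R -> \bar R :=
  fun z => P (Y @^-1` `]-oo, z]).

Definition std_normal_cdf {R : realType} : R -> \bar R :=
  fun z => normal_prob 0 1 `]-oo, z].

(* Main.v *)
Require Import Defs.
From HB Require Import structures.
From mathcomp Require Import all_boot all_order all_algebra.
From mathcomp Require Import all_classical all_reals all_analysis.
From mathcomp Require Import measurable_realfun ring lra.

Set Implicit Arguments.
Unset Strict Implicit.
Unset Printing Implicit Defensive.

Import Order.TTheory GRing.Theory Num.Theory.
Import numFieldNormedType.Exports.
Local Open Scope classical_set_scope.
Local Open Scope ring_scope.

(** Stein's method.  Let [f] be the bounded solution of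
    [f' x - x f x = 1_{x <= z} - Phi z], so that [P (X_1 <= z) - Phi z] is
    [E (f' (X_1)) - E (X_1 f (X_1))].  Exchangeability gives
    [E (ellD (f (X_1) + f (X'_1))) = 0], and the regression condition then
    yields [E (X_1 f (X_1)) =
    (2 lambda)^-1 E (ellD (f (X_1) - f (X'_1))) - E (ellR f (X_1))].
    As [x f x] is nondecreasing and [1_{x <= z}] nonincreasing, replacing
    [f (X_1) - f (X'_1)] by [D_1 f' (X_1)] costs at most
    [D_1 (k (X_1) - k (X'_1))] where [k x = x f x + 1_{x > z} - Phi z].  Since
    [|ellD| D_1] is antisymmetric, the expectation of [|ellD|] times this error
    is [2 E (|ellD| D_1 k (X_1))], and [|k| <= 1].  The other two terms use
    [|f'| <= 1] and [0 <= f <= sqrt (2 pi) / 4].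

    When [ellR] is not integrable the bound is infinite, so [ellR] may be
    assumed integrable even though [X] and [Rv] are not. *)

(** * Monotonicity from the sign of a derivative *)

Section calculus.
Context {R : realType}.
Implicit Types (f df : R -> R) (a b x : R).

Lemma is_derive_mean_value f df a b : a < b ->
  (forall x, a <= x <= b -> is_derive x 1 f (df x)) ->
  exists2 c, a < c < b & f b - f a = df c * (b - a).
Proof.
move=> ab fdf; have [|x|c] := @MVT R f df a b ab.
- by move=> x; rewrite in_itv/= => /andP[ax xb]; apply: fdf; rewrite !ltW.
- apply: derivable_within_continuous => y; rewrite in_itv/= => aby.
  by have [] := fdf _ aby.
- by rewrite in_itv/=; exists c.
Qed.

Lemma is_derive_nonincreasing f df a b : a <= b ->
  (forall x, a <= x <= b -> is_derive x 1 f (df x)) ->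
  (forall x, a < x < b -> df x <= 0) -> f b <= f a.
Proof.
rewrite le_eqVlt => /predU1P[->//|ab] fdf df0.
have [c /df0 dfc fba] := is_derive_mean_value ab fdf.
by rewrite -subr_le0 fba mulr_le0_ge0// subr_ge0 ltW.
Qed.

Lemma is_derive_nondecreasing f df a b : a <= b ->
  (forall x, a <= x <= b -> is_derive x 1 f (df x)) ->
  (forall x, a < x < b -> 0 <= df x) -> f a <= f b.
Proof.
rewrite le_eqVlt => /predU1P[->//|ab] fdf df0.
have [c /df0 dfc fba] := is_derive_mean_value ab fdf.
by rewrite -subr_ge0 fba mulr_ge0// subr_ge0 ltW.
Qed.

(** A negative value would persist to the right by monotonicity, against the lower limit at
    infinity. This yields the Gaussian tail estimates. *)
Lemma nonincreasing_vanishing_ge0 f df a :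
  (forall x, a <= x -> is_derive x 1 f (df x)) ->
  (forall x, a <= x -> df x <= 0) ->
  (forall e, 0 < e -> exists M, forall x, M <= x -> - e < f x) ->
  forall x, a <= x -> 0 <= f x.
Proof.
move=> fdf df0 f0 x ax; rewrite leNgt; apply/negP => fx0.
have [|M /(_ (Num.max x M))] := f0 (- f x); first by rewrite oppr_gt0.
rewrite le_max lexx orbT opprK => /(_ isT); apply/negP; rewrite -leNgt.
apply: (@is_derive_nonincreasing _ df); first by rewrite le_max lexx.
- by move=> y /andP[xy _]; apply/fdf/(le_trans ax).
- by move=> y /andP[xy _]; apply/df0/(le_trans ax)/ltW.
Qed.

End calculus.

(** * The standard normal density and distribution function *)

Section gauss.
Context {R : realType}.
Implicit Types x y z : R.

Definition gauss_pdf x : R := (Num.sqrt (2 * pi))^-1 * expR (- (x ^+ 2 / 2)).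
Definition gauss_cdf x : R := fine (std_normal_cdf x).

Lemma gauss_pdfE : normal_pdf 0 1 = gauss_pdf.
Proof.
rewrite normal_pdfE ?oner_neq0//; apply/funext => x.
rewrite /gauss_pdf /normal_peak /normal_fun expr1n mul1r subr0 mulNr.
by rewrite mulr_natl.
Qed.

Lemma sqrt2pi_gt0 : 0 < Num.sqrt (2 * pi) :> R.
Proof. by rewrite sqrtr_gt0 mulr_gt0// pi_gt0. Qed.

Lemma gauss_pdf_gt0 x : 0 < gauss_pdf x.
Proof. by rewrite mulr_gt0 ?expR_gt0// invr_gt0 sqrt2pi_gt0. Qed.

Lemma gauss_pdfN x : gauss_pdf (- x) = gauss_pdf x.
Proof. by rewrite /gauss_pdf sqrrN. Qed.

Lemma is_derive_gauss_pdf x : is_derive x 1 gauss_pdf (- x * gauss_pdf x).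
Proof.
apply: is_derive_eq.
rewrite /gauss_pdf /GRing.scale/=; field.
by rewrite lt0r_neq0// sqrt2pi_gt0.
Qed.

Lemma std_normal_cdfE x : std_normal_cdf x = (gauss_cdf x)%:E.
Proof. by rewrite /gauss_cdf fineK// fin_num_measure. Qed.

Lemma gauss_cdf_ge0 x : 0 <= gauss_cdf x.
Proof. by rewrite fine_ge0. Qed.

Lemma gauss_cdf_le1 x : gauss_cdf x <= 1.
Proof. by rewrite -lee_fin -std_normal_cdfE probability_le1. Qed.

#[export] Instance is_derive_gauss_cdf x :
  is_derive x 1 gauss_cdf (gauss_pdf x).
Proof.
have xx1 : x < x + 1 by rewrite ltrDl.
have [] := @continuous_FTC1 R (normal_pdf 0 1) -oo%O x _ xx1.
- apply: (integrableS _ _ (subsetT _)) => //.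
  exact: integrable_normal_pdf.
- exact: ltNyr.
- by apply: continuous_normal_pdf; rewrite oner_neq0.
- have -> : gauss_cdf = fun y =>
      \int[lebesgue_measure]_(t in `]-oo, y]) normal_pdf 0 1 t by [].
  move=> dF F'; split; first exact: dF.
  by rewrite -derive1E F' gauss_pdfE.
Qed.

(** As a random variable under [normal_prob 0 1], the identity has [gauss_cdf] as its distribution
    function, which gives the limits at both infinities. *)
Let idR : measurableTypeR R -> R := idfun.

#[local] HB.instance Definition _ :=
  @isMeasurableFun.Build _ _ _ _ idR (@measurable_id _ _ setT).

Lemma gauss_cdf_cvgy (e : R) : 0 < e ->
  exists M, forall x, M <= x -> 1 - e < gauss_cdf x.
Proof.
move=> e0; have := @cvg_cdfy1 _ _ R (normal_prob 0 1) idR.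
move=> /fine_cvgP[_ /cvgrPdist_lt/(_ _ e0)[M [_ HM]]].
exists (M + 1) => x Mx.
have /HM : M < x by rewrite (lt_le_trans _ Mx)// ltrDl.
by rewrite /= ltr_distlC /gauss_cdf => /andP[].
Qed.

Lemma gauss_cdf_cvgNy (e : R) : 0 < e ->
  exists M, forall x, M <= x -> gauss_cdf (- x) < e.
Proof.
move=> e0; have := @cvg_cdfNy0 _ _ R (normal_prob 0 1) idR.
move=> /fine_cvgP[_ /cvgrPdist_lt/(_ _ e0)[M [_ HM]]].
exists (1 - M) => x Mx.
have /HM : - x < M by lra.
by rewrite /= sub0r normrN => /(le_lt_trans (ler_norm _)).
Qed.

(** The density is even, so [gauss_cdf x + gauss_cdf (- x)] has derivative zero; its limit at
    infinity is 1. *)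
Lemma gauss_cdfN x : gauss_cdf (- x) = 1 - gauss_cdf x.
Proof.
pose S (x : R) := gauss_cdf x + gauss_cdf (- x).
have d0 (y : R) : is_derive y 1 S 0.
  rewrite /S; apply: is_derive_eq.
  by rewrite /GRing.scale/= gauss_pdfN; ring.
have cst (y y' : R) : y <= y' ->
    gauss_cdf y + gauss_cdf (- y) = gauss_cdf y' + gauss_cdf (- y').
  move=> yy'; apply/eqP; rewrite eq_le; apply/andP; split.
    exact: (@is_derive_nondecreasing R S (fun=> 0)).
  exact: (@is_derive_nonincreasing R S (fun=> 0)).
apply/eqP; rewrite -subr_eq0 -normr_le0.
apply/ler_addgt0Pr => e e0; rewrite add0r.
have [M1 HM1] := gauss_cdf_cvgy e0.
have [M2 HM2] := gauss_cdf_cvgNy e0.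
pose y := Num.max x (Num.max M1 M2).
have xy : x <= y by rewrite le_max lexx.
have /HM1 h1 : M1 <= y by rewrite !le_max lexx ?orbT.
have /HM2 h2 : M2 <= y by rewrite !le_max lexx ?orbT.
have h3 := cst _ _ xy; have h4 := gauss_cdf_le1 y.
have h5 := gauss_cdf_ge0 (- y).
by rewrite ler_norml; apply/andP; split; lra.
Qed.

Lemma gauss_pdf_cvgy (e : R) : 0 < e ->
  exists M, forall x, M <= x -> gauss_pdf x < e.
Proof.
(* The threshold comes from [exp (x^2 / 2) >= 1 + x^2 / 2 >= x / 2], so that
   [exp (- x^2 / 2) <= 2 / x]. *)
move=> e0; exists (1 + 2 / (Num.sqrt (2 * pi) * e)) => x Mx.
have s0 := sqrt2pi_gt0.
have se0 : 0 < Num.sqrt (2 * pi) * e by rewrite mulr_gt0.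
have x1 : 1 <= x by apply: le_trans Mx; rewrite lerDl divr_ge0// ltW.
have x0 : 0 < x by lra.
have se : 2 / x < Num.sqrt (2 * pi) * e.
  rewrite ltr_pdivrMr// mulrC -ltr_pdivrMr//.
  by apply: lt_le_trans Mx; rewrite ltrDr.
rewrite /gauss_pdf ltr_pdivrMl// expRN; apply: le_lt_trans se.
rewrite -[2 / x]invf_div lef_pV2 ?posrE ?expR_gt0 ?divr_gt0//.
apply: le_trans (expR_ge1Dx _); nra.
Qed.

End gauss.

(** * Mills ratio and Gaussian tail inequalities *)

Section mills.
Context {R : realType}.
Implicit Types x y z : R.

Local Notation phi := (@gauss_pdf R).
Local Notation Phi := (@gauss_cdf R).

(** The upper tail [1 - Phi x] is written [Phi (- x)], so that reflection turns one branch of the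
    Stein solution into the other. *)
Definition mills x : R := Phi (- x) / phi x.

Lemma mills_ge0 x : 0 <= mills x.
Proof. by rewrite divr_ge0 ?gauss_cdf_ge0// ltW// gauss_pdf_gt0. Qed.

Lemma is_derive_mills x : is_derive x 1 mills (x * mills x - 1).
Proof.
have phi0 := gauss_pdf_gt0 x; have phiN0 := lt0r_neq0 phi0.
have dphi := is_derive_gauss_pdf x.
apply: is_derive_eq.
rewrite /mills /GRing.scale/= gauss_pdfN.
by field.
Qed.

(** The gap [phi y / y - Phi (- y)] decreases on the positive axis and vanishes at infinity. *)
Lemma gauss_tail_ub x : 0 < x -> x * Phi (- x) <= phi x.
Proof.
move=> x0; rewrite mulrC -ler_pdivlMr// -subr_ge0.
pose s y := phi y / y - Phi (- y).
have sE y : 0 < y -> is_derive y 1 s (- (phi y / y ^+ 2)).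
  move=> y0; have yN0 := lt0r_neq0 y0.
  have dV := is_deriveV (f := id) yN0 (is_derive_id y 1).
  have dphi := is_derive_gauss_pdf y.
  rewrite /s; apply: is_derive_eq.
  rewrite /GRing.scale/= gauss_pdfN; field.
  exact: yN0.
rewrite -[_ - _]/(s x).
apply: (@nonincreasing_vanishing_ge0 R s (fun y => - (phi y / y ^+ 2)) x) => //.
- by move=> y xy; apply: sE; exact: lt_le_trans xy.
- by move=> y _; rewrite oppr_le0 divr_ge0 ?sqr_ge0// ltW// gauss_pdf_gt0.
- move=> e /gauss_cdf_cvgNy[M HM]; exists (Num.max 1 M) => y.
  rewrite ge_max => /andP[y1 /HM]; rewrite /s => hN.
  have : 0 <= phi y / y by rewrite divr_ge0 ?(ltW (gauss_pdf_gt0 _))//; lra.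
  by lra.
Qed.

Lemma mulr_mills_le1 x : x * mills x <= 1.
Proof.
rewrite mulrA ler_pdivrMr ?gauss_pdf_gt0// mul1r.
have [/gauss_tail_ub//|x0] := ltP 0 x.
apply: le_trans (ltW (gauss_pdf_gt0 x)).
by rewrite mulr_le0_ge0 ?gauss_cdf_ge0.
Qed.

(** The gap, once divided by [1 + y^2], decreases on the whole line and vanishes at infinity.
    Holding for every sign of [x], this makes [x * mills x] monotone everywhere: it says that the
    derivative is nonnegative. *)
Lemma gauss_tail_lb x : x * phi x <= (1 + x ^+ 2) * Phi (- x).
Proof.
have p1 y : 0 < 1 + y ^+ 2 :> R by rewrite ltr_wpDr// sqr_ge0.
rewrite mulrC -ler_pdivrMl// -subr_ge0.
pose s y := Phi (- y) - (1 + y ^+ 2)^-1 * (phi y * y).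
have sE y : is_derive y 1 s (- (2 * phi y / (1 + y ^+ 2) ^+ 2)).
  have yN0 := lt0r_neq0 (p1 y); have dphi := is_derive_gauss_pdf y.
  rewrite /s; apply: is_derive_eq.
  rewrite /GRing.scale/= gauss_pdfN; field.
  exact: lt0r_neq0.
rewrite -[_ - _]/(s x).
apply: (@nonincreasing_vanishing_ge0 R s
  (fun y => - (2 * phi y / (1 + y ^+ 2) ^+ 2)) x) => //.
- move=> y _; rewrite oppr_le0 divr_ge0 ?sqr_ge0// mulr_ge0//.
  by rewrite ltW// gauss_pdf_gt0.
- move=> e /gauss_pdf_cvgy[M HM]; exists (Num.max 1 M) => y.
  rewrite ge_max => /andP[y1 /HM]; rewrite /s => hN.
  suff : (1 + y ^+ 2)^-1 * (phi y * y) <= phi y.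
    by have := gauss_cdf_ge0 (- y); lra.
  rewrite ler_pdivrMl// [leRHS]mulrC; apply: ler_wpM2l.
    by rewrite ltW// gauss_pdf_gt0.
  by nra.
Qed.

Lemma mulr_mills_nondecreasing x y : x <= y -> x * mills x <= y * mills y.
Proof.
move=> xy; apply: (@is_derive_nondecreasing R (fun x => x * mills x)
  (fun x => (1 + x ^+ 2) * mills x - x)) => //.
- move=> t _; have dm := is_derive_mills t; apply: is_derive_eq.
  by rewrite /GRing.scale/=; ring.
- move=> t _; rewrite subr_ge0 mulrA ler_pdivlMr ?gauss_pdf_gt0//.
  exact: gauss_tail_lb.
Qed.

Lemma mills_nonincreasing x y : x <= y -> mills y <= mills x.
Proof.
move=> xy; apply: (is_derive_nonincreasing xy (fun t _ => is_derive_mills t)).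
by move=> t _; rewrite subr_le0 mulr_mills_le1.
Qed.

(* [u = exp (- x^2 / 2) / 4 - Phi x (1 - Phi x)] has derivative [phi q] with
   [q] concave on [0, +oo[ and [u 0 = q 0 = 0], so once [u] is negative it
   stays below a negative value, whereas it tends to [0] at infinity. *)
Lemma gauss_cdf_mulN_le x : Phi x * Phi (- x) <= expR (- (x ^+ 2 / 2)) / 4.
Proof.
wlog x0 : x / 0 <= x.
  move=> h; have [/h//|x0] := leP 0 x.
  by have := h (- x); rewrite opprK sqrrN mulrC; apply; lra.
rewrite leNgt; apply/negP => ux0.
set s2 : R := Num.sqrt (2 * pi).
have s0 : 0 < s2 := sqrt2pi_gt0.
have sN0 := lt0r_neq0 s0.
have eE t : expR (- (t ^+ 2 / 2)) = s2 * phi t.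
  by rewrite /gauss_pdf mulrA divff// mul1r.
pose u t := s2 / 4 * phi t - Phi t * Phi (- t).
pose q t := Phi t - Phi (- t) - s2 / 4 * t.
have {}ux0 : u x < 0 by rewrite /u; move: ux0; rewrite eE; lra.
have du (t : R) : is_derive t 1 u (phi t * q t).
  have dphi := is_derive_gauss_pdf t.
  rewrite /u; apply: is_derive_eq.
  by rewrite /q /GRing.scale/= gauss_pdfN; ring.
have dq (t : R) : is_derive t 1 q (2 * phi t - s2 / 4).
  by rewrite /q; apply: is_derive_eq; rewrite /GRing.scale/= gauss_pdfN; ring.
have Phi0 : Phi 0 = 1 / 2 by have := gauss_cdfN (0 : R); rewrite oppr0; lra.
have q0 : q 0 = 0 by rewrite /q oppr0; lra.
have u0 : u 0 = 0.
  rewrite /u oppr0 Phi0 /gauss_pdf expr0n/= mul0r oppr0 expR0 -/s2.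
  by field.
have {}x0 : 0 < x.
  by rewrite lt_neqAle x0 andbT; apply: contraTneq ux0 => <-; rewrite u0 ltxx.
(* As [u 0 = 0], a mean value gives [c] with [q c < 0]; as [q 0 = 0], another gives [c' < c] where
   [q] has negative derivative. Since [phi] decreases on the positive axis, [q] decreases beyond
   [c'] and [u] beyond [c]. *)
have [c /andP[c0 cx] uc] := is_derive_mean_value x0 (fun t _ => du t).
have qc : q c < 0.
  rewrite -(pmulr_rlt0 _ (gauss_pdf_gt0 c)) -(pmulr_llt0 _ x0).
  by move: uc; rewrite u0 !subr0 => <-.
have [c' /andP[c'0 c'c] qc'] := is_derive_mean_value c0 (fun t _ => dq t).
have dq_lt0 t : c' <= t -> 2 * phi t - s2 / 4 <= 0.
  move=> c't; have : 2 * phi c' - s2 / 4 < 0.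
    by rewrite -(pmulr_llt0 _ c0); move: qc'; rewrite q0 !subr0 => <-.
  suff : phi t <= phi c' by lra.
  rewrite /gauss_pdf ler_pM2l ?invr_gt0// ler_expR lerN2 ler_pM2r//.
  by rewrite ler_sqr ?nnegrE//; lra.
have q_lt0 t : c <= t -> q t <= 0.
  move=> ct; apply: le_trans (ltW qc).
  apply: (is_derive_nonincreasing ct (fun t _ => dq t)) => r /andP[cr _].
  by apply: dq_lt0; lra.
suff : 0 <= u x by rewrite leNgt ux0.
apply: (@nonincreasing_vanishing_ge0 R u (fun t => phi t * q t) x) => //.
  by move=> t xt; rewrite mulr_ge0_le0 ?q_lt0 ?(ltW (gauss_pdf_gt0 _))//; lra.
move=> e /gauss_cdf_cvgNy[M HM]; exists M => t /HM Nt; rewrite /u.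
have : 0 <= s2 / 4 * phi t by rewrite mulr_ge0 ?(ltW (gauss_pdf_gt0 _))//; lra.
have := gauss_cdf_ge0 t; have := gauss_cdf_le1 t; have := gauss_cdf_ge0 (- t).
by nra.
Qed.

End mills.

(** * The Stein solution and its bounds *)

Section stein.
Context {R : realType}.
Implicit Types x y z : R.

Local Notation phi := (@gauss_pdf R).
Local Notation Phi := (@gauss_cdf R).

(** Since [mills (- x) = Phi x / phi x], this is the usual closed form of the bounded solution; the
    two branches agree at [z]. *)
Definition stein z x : R :=
  if x <= z then Phi (- z) * mills (- x) else Phi z * mills x.

(* The value at [x = z], where [stein z] is not differentiable, is the left
   derivative; it makes the Stein equation hold everywhere. *)
Definition dstein z x : R := x * stein z x + (x <= z)%R%:R - Phi z.

(* [dstein z] with its indicator reflected, so that it is nondecreasing: its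
   increments bound the variation of [dstein z] between two points. *)
Definition stein_var z x : R := x * stein z x + (z < x)%R%:R - Phi z.

Lemma steinE_ge z x : z <= x -> stein z x = Phi z * mills x.
Proof.
rewrite le_eqVlt /stein => /predU1P[<-|zx]; last by rewrite leNgt zx.
by rewrite lexx /mills opprK gauss_pdfN; ring.
Qed.

Lemma stein_ge0 z x : 0 <= stein z x.
Proof.
by rewrite /stein; case: ifP => _; rewrite mulr_ge0 ?mills_ge0 ?gauss_cdf_ge0.
Qed.

(** Each branch is a nonnegative multiple of [x * mills x], or of its reflection; the two are glued
    at [z]. *)
Lemma mulr_stein_nondecreasing z x y : x <= y -> x * stein z x <= y * stein z y.
Proof.
have left a b : a <= b -> b <= z -> a * stein z a <= b * stein z b.
  move=> ab bz; rewrite /stein bz (le_trans ab bz).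
  rewrite mulrCA [leRHS]mulrCA ler_wpM2l ?gauss_cdf_ge0//.
  have : - b <= - a by rewrite lerN2.
  by move=> /mulr_mills_nondecreasing; rewrite !mulNr lerN2.
have right a b : a <= b -> z <= a -> a * stein z a <= b * stein z b.
  move=> ab za; rewrite !steinE_ge// ?(le_trans za)//.
  rewrite mulrCA [leRHS]mulrCA ler_wpM2l ?gauss_cdf_ge0//.
  exact: mulr_mills_nondecreasing.
move=> xy; have [yz|/ltW zy] := leP y z; first exact: left.
have [xz|/ltW zx] := leP x z; last exact: right.
exact: le_trans (left _ _ xz _) (right _ _ zy _).
Qed.

Lemma mulr_stein_le z x : x * stein z x <= Phi z.
Proof.
have [xz|/ltW zx] := leP x z.
  apply: le_trans (mulr_stein_nondecreasing z xz) _.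
  by rewrite steinE_ge// mulrCA ler_piMr ?gauss_cdf_ge0 ?mulr_mills_le1.
by rewrite steinE_ge// mulrCA ler_piMr ?gauss_cdf_ge0 ?mulr_mills_le1.
Qed.

Lemma mulr_stein_ge z x : Phi z - 1 <= x * stein z x.
Proof.
have left y : y <= z -> Phi z - 1 <= y * stein z y.
  move=> yz; rewrite /stein yz -opprB -gauss_cdfN lerNl -mulNr mulrCA.
  by rewrite ler_piMr ?gauss_cdf_ge0 ?mulr_mills_le1.
have [xz|/ltW zx] := leP x z; first exact: left.
exact: le_trans (left z _) (mulr_stein_nondecreasing z zx).
Qed.

Lemma norm_dstein_le1 z x : `|dstein z x| <= 1.
Proof.
have := mulr_stein_le z x; have := mulr_stein_ge z x.
have := gauss_cdf_ge0 z; have := gauss_cdf_le1 z.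
by rewrite ler_norml /dstein; case: (leP x z) => _ /= *;
  apply/andP; split; lra.
Qed.

Lemma norm_stein_var_le1 z x : `|stein_var z x| <= 1.
Proof.
have := mulr_stein_le z x; have := mulr_stein_ge z x.
have := gauss_cdf_ge0 z; have := gauss_cdf_le1 z.
by rewrite ler_norml /stein_var; case: (ltP z x) => _ /= *;
  apply/andP; split; lra.
Qed.

(** A mean value inequality that survives the kink at [z]: each smooth branch is treated separately,
    and an interval containing [z] is cut there. *)
Lemma stein_increment_bounds z a b lo hi : a <= b ->
  (forall c, a <= c <= b -> lo <= dstein z c <= hi) ->
  lo * (b - a) <= stein z b - stein z a <= hi * (b - a).
Proof.
have left c e : c <= e -> e <= z ->
    (forall t, c <= t <= e -> lo <= dstein z t <= hi) ->
    lo * (e - c) <= stein z e - stein z c <= hi * (e - c).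
  rewrite le_eqVlt => /predU1P[->|ce] ez h; first by rewrite !subrr !mulr0 lexx.
  have [|t /andP[ct te] E] := @is_derive_mean_value R
      (fun x => Phi (- z) * mills (- x))
      (fun x => x * (Phi (- z) * mills (- x)) + Phi (- z)) _ _ ce.
    move=> t _; have dm := is_derive_mills (- t); apply: is_derive_eq.
    by rewrite /GRing.scale/=; ring.
  have tz : t <= z by lra.
  have : lo <= dstein z t <= hi by apply: h; rewrite !ltW.
  rewrite /dstein /stein tz ez (ltW (lt_le_trans ce ez)) E -addrA -gauss_cdfN.
  by rewrite !ler_pM2r ?subr_gt0.
have right c e : c <= e -> z <= c ->
    (forall t, c <= t <= e -> lo <= dstein z t <= hi) ->
    lo * (e - c) <= stein z e - stein z c <= hi * (e - c).
  rewrite le_eqVlt => /predU1P[->|ce] zc h; first by rewrite !subrr !mulr0 lexx.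
  have [|t /andP[ct te] E] := @is_derive_mean_value R
      (fun x => Phi z * mills x)
      (fun x => x * (Phi z * mills x) - Phi z) _ _ ce.
    move=> t _; have dm := is_derive_mills t; apply: is_derive_eq.
    by rewrite /GRing.scale/=; ring.
  (* Strictness matters: only to the right of [z] does the indicator in [dstein] vanish. *)
  have zt : z < t by lra.
  have : lo <= dstein z t <= hi by apply: h; rewrite !ltW.
  rewrite !steinE_ge//; last by rewrite (le_trans zc)// ltW.
  rewrite /dstein steinE_ge ?(ltW zt)// (leNgt t) zt/= addr0 E.
  by rewrite !ler_pM2r ?subr_gt0.
move=> ab h; have [bz|/ltW zb] := leP b z; first exact: left.
have [az|/ltW za] := leP a z; last exact: right.
have /andP[l1 l2] : lo * (z - a) <= stein z z - stein z a <= hi * (z - a).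
  by apply: left => // t /andP[at_ tz]; apply: h; rewrite at_ (le_trans tz).
have /andP[r1 r2] : lo * (b - z) <= stein z b - stein z z <= hi * (b - z).
  by apply: right => // t /andP[zt tb]; apply: h; rewrite tb (le_trans az).
by apply/andP; split; lra.
Qed.

(** The maximum is at [x = z], with value [Phi z * Phi (- z) / phi z]. *)
Lemma stein_le z x : stein z x <= Num.sqrt (2 * pi) / 4.
Proof.
apply: (@le_trans _ _ (stein z z)).
  have [xz|/ltW zx] := leP x z.
    rewrite /stein xz lexx ler_wpM2l ?gauss_cdf_ge0//.
    by apply: mills_nonincreasing; rewrite lerN2.
  rewrite !steinE_ge// ler_wpM2l ?gauss_cdf_ge0//.
  exact: mills_nonincreasing.
rewrite steinE_ge// mulrA ler_pdivrMr ?gauss_pdf_gt0//.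
apply: le_trans (gauss_cdf_mulN_le z) _.
rewrite /gauss_pdf [X in X <= _](_ : _ = Num.sqrt (2 * pi) / 4 *
  ((Num.sqrt (2 * pi))^-1 * expR (- (z ^+ 2 / 2))))//.
by field; rewrite lt0r_neq0// sqrt2pi_gt0.
Qed.

(** Both [dstein z x] and the slope of [stein z] between [x] and [y] lie in an interval whose length
    is the absolute increment of [stein_var z]. The bound needs no absolute value because
    [stein_var] is monotone; staying linear in [stein_var], it is open to the antisymmetry
    argument. *)
Lemma stein_taylor z x y :
  `|(x - y) * dstein z x - (stein z x - stein z y)| <=
  (x - y) * (stein_var z x - stein_var z y).
Proof.
have ind t : (z < t)%R%:R = 1 - (t <= z)%R%:R :> R.
  by case: leP => _ /=; ring.
have ind_homo a b : a <= b -> (b <= z)%R%:R <= (a <= z)%R%:R :> R.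
  move=> ab; rewrite ler_nat; case: (leP b z) => // bz.
  by rewrite (le_trans ab bz).
rewrite /stein_var !ind ler_norml.
have [yx|/ltW xy] := leP y x.
- have B c : y <= c <= x -> y * stein z y + (x <= z)%R%:R - Phi z
      <= dstein z c <= x * stein z x + (y <= z)%R%:R - Phi z.
    move=> /andP[ac cb]; rewrite /dstein.
    have := mulr_stein_nondecreasing z ac.
    have := mulr_stein_nondecreasing z cb.
    have := ind_homo _ _ ac; have := ind_homo _ _ cb.
    by move=> *; apply/andP; split; lra.
  have /andP[] := stein_increment_bounds yx B.
  have : 0 <= (x - y) * (x * stein z x - y * stein z y).
    by rewrite mulr_ge0 ?subr_ge0 ?mulr_stein_nondecreasing.
  have : 0 <= (x - y) * ((y <= z)%R%:R - (x <= z)%R%:R).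
    by rewrite mulr_ge0 ?subr_ge0 ?ind_homo.
  by rewrite /dstein => *; apply/andP; split; lra.
- have B c : x <= c <= y -> x * stein z x + (y <= z)%R%:R - Phi z
      <= dstein z c <= y * stein z y + (x <= z)%R%:R - Phi z.
    move=> /andP[ac cb]; rewrite /dstein.
    have := mulr_stein_nondecreasing z ac.
    have := mulr_stein_nondecreasing z cb.
    have := ind_homo _ _ ac; have := ind_homo _ _ cb.
    by move=> *; apply/andP; split; lra.
  have /andP[] := stein_increment_bounds xy B.
  have : 0 <= (y - x) * (y * stein z y - x * stein z x).
    by rewrite mulr_ge0 ?subr_ge0 ?mulr_stein_nondecreasing.
  have : 0 <= (y - x) * ((x <= z)%R%:R - (y <= z)%R%:R).
    by rewrite mulr_ge0 ?subr_ge0 ?ind_homo.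
  by rewrite /dstein => *; apply/andP; split; lra.
Qed.

Lemma measurable_stein z : measurable_fun setT (stein z).
Proof.
have mm (u : R -> R) :
    measurable_fun setT u -> measurable_fun setT (mills \o u).
  apply: measurableT_comp; apply: nonincreasing_measurable => // x y.
  exact: mills_nonincreasing.
apply: measurable_fun_ifT => /=.
- exact: measurable_fun_ler.
- by apply: measurable_funM => //; apply: mm.
- apply: measurable_funM; first exact: measurable_cst.
  exact: (mm idfun (@measurable_id _ _ _)).
Qed.

Lemma measurable_dstein z : measurable_fun setT (dstein z).
Proof.
apply: measurable_funB => //; apply: measurable_funD.
  by apply: measurable_funM => //; exact: measurable_stein.
apply: nonincreasing_measurable => // x y xy; rewrite ler_nat.
by case: (leP y z) => // yz; rewrite (le_trans xy yz).
Qed.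

Lemma measurable_stein_var z : measurable_fun setT (stein_var z).
Proof.
apply: measurable_funB => //; apply: measurable_funD.
  by apply: measurable_funM => //; exact: measurable_stein.
apply: nondecreasing_measurable => // x y xy; rewrite ler_nat.
by case: (ltP z x) => // zx; rewrite (lt_le_trans zx xy).
Qed.

End stein.

(** * Real-valued integrals against bounded functions *)

Section integrals.
Context {d : measure_display} {T : measurableType d} {R : realType}.
Variable P : probability T R.
Implicit Types (f g h Y W : T -> R) (M : R).

Local Notation Rintegrable f := (P.-integrable setT (EFin \o f)).

Lemma Rintegrable_measurable f : Rintegrable f -> measurable_fun setT f.
Proof. by move=> /measurable_int/measurable_EFinP. Qed.

Lemma RintegrableB f g : Rintegrable f -> Rintegrable g ->
  Rintegrable (fun t => f t - g t).
Proof. by move=> fi gi; exact: (integrableB _ fi gi). Qed.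

Lemma RintegrableZl (k : R) f : Rintegrable f -> Rintegrable (fun t => k * f t).
Proof. by move=> fi; exact: (integrableZl _ k fi). Qed.

Lemma Rintegrable_mul_bounded f h M : Rintegrable f -> measurable_fun setT h ->
  (forall t, `|h t| <= M) -> Rintegrable (fun t => f t * h t).
Proof.
move=> fi mh hM; apply: (le_integrable _ _ _ (RintegrableZl M fi)) => //.
  apply/measurable_EFinP/measurable_funM => //.
  exact: Rintegrable_measurable.
move=> t _ /=; rewrite lee_fin normrM mulrC normrM ler_wpM2r//.
exact: le_trans (hM t) (ler_norm _).
Qed.

Lemma Rintegrable_bounded h M : measurable_fun setT h ->
  (forall t, `|h t| <= M) -> Rintegrable h.
Proof.
move=> mh hM; rewrite (_ : h = fun t => cst 1 t * h t); last first.
  by apply/funext => t; rewrite mul1r.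
apply: (@Rintegrable_mul_bounded (cst 1) h M) => //.
by apply: finite_measure_integrable_cst.
Qed.

Lemma norm_Rintegral_mul_le f h M : Rintegrable f -> measurable_fun setT h ->
  (forall t, `|h t| <= M) ->
  `|\int[P]_t (f t * h t)| <= M * \int[P]_t `|f t|.
Proof.
move=> fi mh hM; have fhi := Rintegrable_mul_bounded fi mh hM.
apply: (le_trans (le_normr_Rintegral measurableT fhi)).
rewrite -RintegralZl//; last exact: integrable_norm.
apply: le_Rintegral => //.
- exact: (integrable_norm fhi).
- by apply: RintegrableZl; exact: (integrable_norm fi).
- by move=> t _; rewrite normrM mulrC ler_wpM2r.
Qed.

Lemma Rintegral_sum n (F : 'I_n -> T -> R) : (forall k, Rintegrable (F k)) ->
  \int[P]_t (\sum_(k < n) F k t) = \sum_(k < n) \int[P]_t F k t.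
Proof.
elim: n F => [F _|n IH F Fi].
  under eq_Rintegral do rewrite big_ord0.
  by rewrite Rintegral_cst// mul0r big_ord0.
under eq_Rintegral do rewrite big_ord_recr/=.
rewrite RintegralD//; first by rewrite IH// big_ord_recr.
rewrite (_ : _ \o _ =
  fun x => (\sum_(i < n) (F (widen_ord (leqnSn n) i) x)%:E)%E).
  by apply: integrable_sum => // i _; exact: Fi.
by apply/funext => x /=; rewrite sumEFin.
Qed.

End integrals.

(** The sum counts the multiples of [1 / n] in []0, x]], so it is the integer part of [n x]. Thus a
    function into [[0, 1]] is uniformly close to a mean of indicators of its level sets. *)
Lemma mean_level_indicator {R : realType} (x : R) n :
  0 <= x <= 1 -> (0 < n)%N ->
  `|x - n%:R^-1 * \sum_(k < n) (k.+1%:R / n%:R <= x)%R%:R| <= n%:R^-1.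
Proof.
move=> /andP[x0 x1] n0; have n0' : 0 < n%:R :> R by rewrite ltr0n.
set m := Num.truncn (n%:R * x).
have /andP[m1 m2] : m%:R <= n%:R * x < m.+1%:R.
  by apply: truncn_itv; rewrite mulr_ge0// ltW.
have mn : (m <= n)%N.
  by rewrite -(@ler_nat R) (le_trans m1)// ler_piMr// ltW.
have -> : \sum_(k < n) (k.+1%:R / n%:R <= x)%R%:R = m%:R :> R.
  rewrite (eq_bigr (fun k : 'I_n => (k < m)%N%:R)); last first.
    by move=> k _; rewrite ler_pdivrMr// [x * _]mulrC truncn_gt_nat.
  rewrite -natr_sum -big_mkcond/= -(big_ord_widen n (fun=> 1%N) mn).
  by rewrite sum1_card card_ord.
rewrite -[X in X - _](mulKf (lt0r_neq0 n0')) -mulrBr normrM.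
have nV0 : 0 <= n%:R^-1 :> R by rewrite invr_ge0 ltW.
rewrite ger0_norm// ler_piMr//.
rewrite ler_norml; move: m2; rewrite -natr1 => m2; apply/andP; split; lra.
Qed.

(** * Conditional expectations tested against bounded functions *)

Section conditional_expectation.
Context {d : measure_display} {T : measurableType d} {R : realType}.
Variable P : probability T R.
Implicit Types (f g h Y W : T -> R) (M : R).

Local Notation Rintegrable f := (P.-integrable setT (EFin \o f)).

(** The level sets of [h] belong to [G], so [f] integrates to 0 against the step approximation
    [s n], which is within [1 / n] of [h]. *)
Let Rintegral_mul_unit (G : set (set T)) f h : Rintegrable f ->
  (forall A, G A -> measurable A -> \int[P]_(t in A) f t = 0) ->
  measurable_fun setT h -> (forall B, measurable B -> G (h @^-1` B)) ->
  (forall t, 0 <= h t <= 1) -> \int[P]_t (f t * h t) = 0.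
Proof.
move=> fi f0 mh Gh h01.
pose s n t : R := n%:R^-1 * \sum_(k < n) (k.+1%:R / n%:R <= h t)%R%:R.
have mI (c : R) : measurable (h @^-1` `[c, +oo[).
  by rewrite -[X in measurable X]setTI; exact: mh.
have indE (c : R) t : (c <= h t)%R%:R = \1_(h @^-1` `[c, +oo[) t :> R.
  rewrite indicE; congr (nat_of_bool _)%:R.
  by apply/idP/idP; rewrite inE/= in_itv/= andbT.
have ms n : measurable_fun setT (s n).
  apply: measurable_funM; first exact: measurable_cst.
  apply: measurable_sum => k.
  by rewrite (funext (indE _)); exact: measurable_indic.
have fIi (c : R) : Rintegrable (fun t => f t * (c <= h t)%R%:R).
  apply: (@Rintegrable_mul_bounded _ _ _ _ _ _ 1) => //.
    by rewrite (funext (indE _)); exact: measurable_indic.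
  by move=> t; rewrite normr_nat lern1 leq_b1.
have int0 n : \int[P]_t (f t * s n t) = 0.
  under eq_Rintegral do rewrite /s mulrCA mulr_sumr.
  rewrite RintegralZl//; last first.
    rewrite (_ : _ \o _ = fun x =>
      (\sum_(k < n) (f x * (k.+1%:R / n%:R <= h x)%R%:R)%:E)%E).
      by apply: integrable_sum => // k _; exact: fIi.
    by apply/funext => x /=; rewrite sumEFin.
  rewrite Rintegral_sum// big1 ?mulr0// => k _.
  rewrite -[RHS](f0 (h @^-1` `[(k.+1%:R / n%:R), +oo[)) //; last by apply: Gh.
  rewrite [RHS]Rintegral_mkcond; apply: eq_Rintegral => t _.
  by rewrite indE patchE indicE; case: (_ \in _); rewrite ?mulr1 ?mulr0.
apply/eqP; rewrite -normr_le0; apply/ler_addgt0Pr => e e0; rewrite add0r.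
set C := \int[P]_t `|f t|.
have C0 : 0 <= C by apply: Rintegral_ge0.
(* Chosen so that the error [C / n] is at most [e]. *)
pose n := (Num.truncn (C / e)).+1.
have n0 : 0 < n%:R :> R by rewrite ltr0n.
have hb t : `|h t| <= 1.
  by have /andP[h0 h1] := h01 t; rewrite ger0_norm.
have fhi := Rintegrable_mul_bounded fi mh hb.
have hsn t : `|h t - s n t| <= n%:R^-1 by exact: mean_level_indicator.
have mhs := measurable_funB mh (ms n).
have := norm_Rintegral_mul_le fi mhs hsn.
have -> : \int[P]_t (f t * (h t - s n t)) = \int[P]_t (f t * h t).
  under eq_Rintegral do rewrite mulrBr.
  rewrite RintegralB ?int0 ?subr0//.
  have := RintegrableB fhi (Rintegrable_mul_bounded fi mhs hsn).
  apply: eq_integrable => // t _ /=; congr EFin; ring.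
move=> /le_trans; apply; rewrite ler_pdivrMl// mulrC -ler_pdivrMl// mulrC.
exact/ltW/truncnS_gt.
Qed.

(** An affine change brings [h] into [[0, 1]], where [Rintegral_mul_unit] applies to [Y - W]. *)
Lemma cond_exp_mul_bounded (G : set (set T)) Y W h M :
  cond_exp_version P G Y W ->
  measurable_fun setT h -> (forall B, measurable B -> G (h @^-1` B)) ->
  (forall t, `|h t| <= M) ->
  \int[P]_t (Y t * h t) = \int[P]_t (W t * h t).
Proof.
move=> [Yi Wi _ YW] mh Gh hM.
pose N := `|M| + 1.
have N0 : 0 < N by rewrite ltr_wpDl.
have N2 : 2 * N != 0 by rewrite mulf_neq0// lt0r_neq0.
pose h' t := (h t + N) / (2 * N).
have mh' : measurable_fun setT h'.
  by apply: measurable_funM => //; exact: measurable_funD.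
have YWi := RintegrableB Yi Wi.
have YW0 A : G A -> measurable A -> \int[P]_(t in A) (Y t - W t) = 0.
  move=> GA mA; rewrite RintegralB//; last 2 first.
  - by apply: integrableS Yi.
  - by apply: integrableS Wi.
  by rewrite /Rintegral YW// subrr.
have hN t : - N <= h t <= N.
  by rewrite -ler_norml (le_trans (hM t))// (le_trans (ler_norm _))// lerDl.
have h'0 : \int[P]_t ((Y t - W t) * h' t) = 0.
  apply: (Rintegral_mul_unit YWi YW0 mh').
    move=> B mB; have := Gh ((fun x : R => (x + N) / (2 * N)) @^-1` B).
    apply; rewrite -[X in measurable X]setTI.
    suff : measurable_fun setT (fun x : R => (x + N) / (2 * N)) by apply.
    by apply: measurable_funM => //; exact: measurable_funD.
  move=> t; have /andP[h1 h2] := hN t.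
  rewrite divr_ge0 ?ler_pdivrMr ?mulr_gt0//; [lra|lra|].
  by rewrite mulr_ge0// ltW.
(* The constant part of the affine change requires [Y - W] to have integral 0 on the whole space. *)
have GT : G setT by rewrite -(preimage_setT h); exact: Gh.
have Yhi := Rintegrable_mul_bounded Yi mh hM.
have Whi := Rintegrable_mul_bounded Wi mh hM.
apply/eqP; rewrite -subr_eq0 -RintegralB//.
rewrite (_ : \int[P]_t _ =
  \int[P]_t (2 * N * ((Y t - W t) * h' t) - N * (Y t - W t))).
  have YWh'i : Rintegrable (fun t => (Y t - W t) * h' t).
    apply: (@Rintegrable_mul_bounded _ _ _ _ _ _ 1) => // t.
    have /andP[h1 h2] := hN t.
    rewrite ler_norml /h' ler_pdivrMr ?ler_pdivlMr ?mulr_gt0//.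
    by apply/andP; split; lra.
  rewrite RintegralB//; [|exact: RintegrableZl|exact: RintegrableZl].
  by rewrite !RintegralZl// h'0 YW0// !mulr0 subrr.
by apply: eq_Rintegral => t _; rewrite /h'; field; exact: lt0r_neq0.
Qed.

End conditional_expectation.

(** * Antisymmetric functions of an exchangeable pair *)

Section exchangeability.
Context {dT : measure_display} {T : measurableType dT} {R : realType}.
Variables (P : probability T R) (d : nat) (X X' : 'I_d -> T -> R).
Hypotheses (mX : forall i, measurable_fun setT (X i))
  (mX' : forall i, measurable_fun setT (X' i)).

Lemma measurable_vec_of (Y : 'I_d -> T -> R) :
  (forall i, measurable_fun setT (Y i)) -> measurable_fun setT (vec_of Y).
Proof.
move=> mY; apply/measurable_fun_tnthP => i.
by rewrite (_ : _ \o _ = Y i)//; apply/funext => t /=; rewrite tnth_mktuple.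
Qed.

(** Swapping the two vectors preserves the joint law, hence the expectation, while it changes the
    sign of [A] and moves [h] to the other vector. *)
Lemma exchangeable_antisymmetric (A : d.-tuple R * d.-tuple R -> R)
    (h : d.-tuple R -> R) (M : R) :
  exchangeable_pair P X X' ->
  measurable_fun setT A -> (forall x y, A (y, x) = - A (x, y)) ->
  P.-integrable setT (EFin \o (fun t => A (vec_of X t, vec_of X' t))) ->
  measurable_fun setT h -> (forall x, `|h x| <= M) ->
  \int[P]_t (A (vec_of X t, vec_of X' t) * h (vec_of X' t)) =
  - \int[P]_t (A (vec_of X t, vec_of X' t) * h (vec_of X t)).
Proof.
move=> exch mA AN Ai mh hM.
have mvX := measurable_vec_of mX; have mvX' := measurable_vec_of mX'.
pose F (p : d.-tuple R * d.-tuple R) := A p * h p.2.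
have mF : measurable_fun setT (EFin \o F).
  by apply/measurable_EFinP/measurable_funM => //; exact: measurableT_comp.
have mp : measurable_fun setT (fun t => (vec_of X t, vec_of X' t)).
  exact: measurable_fun_pair.
have mp' : measurable_fun setT (fun t => (vec_of X' t, vec_of X t)).
  exact: measurable_fun_pair.
have Fi : P.-integrable setT
    ((EFin \o F) \o (fun t => (vec_of X t, vec_of X' t))).
  apply: (Rintegrable_mul_bounded Ai (h := h \o vec_of X') (M := M)).
    exact: measurableT_comp.
  by move=> t; exact: hM.
have Ahi : P.-integrable setT
    (EFin \o (fun t => A (vec_of X t, vec_of X' t) * h (vec_of X t))).
  apply: (Rintegrable_mul_bounded Ai (h := h \o vec_of X) (M := M)).
    exact: measurableT_comp.
  by move=> t; exact: hM.
have F'i : P.-integrable setT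
    ((EFin \o F) \o (fun t => (vec_of X' t, vec_of X t))).
  apply: eq_integrable (RintegrableZl (-1) Ahi) => // t _ /=.
  by rewrite /F/= (AN (vec_of X t)) mulN1r mulNr.
transitivity (\int[P]_t F (vec_of X' t, vec_of X t)); last first.
  under eq_Rintegral do rewrite /F/= AN mulNr -mulN1r.
  by rewrite RintegralZl// mulN1r.
rewrite /Rintegral; congr fine.
have := @integral_pushforward _ _ _ _ R _ mp P setT _ mF Fi measurableT.
have := @integral_pushforward _ _ _ _ R _ mp' P setT _ mF F'i measurableT.
rewrite !preimage_setT => <- <-.
by apply: eq_measure_integral => B mB _; exact: exch.
Qed.

End exchangeability.

(** * The bound at a fixed level, for real random variables *)

Section stein_bound.
Context {dT : measure_display} {T : measurableType dT} {R : realType}.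
(** Here [W], [W'] stand for the first components, [L] for [ellD], [Q] for [ellR], and [W1], [W2]
    for the conditional expectations of [L D] and [|L| D]. The hypotheses are tested on bounded
    functions so as to apply to [stein], [dstein] and [stein_var]. *)
Variables (P : probability T R) (W W' L Q W1 W2 : T -> R) (lambda : R).

Local Notation Rintegrable f := (P.-integrable setT (EFin \o f)).
Local Notation D := (fun t => W t - W' t).

Hypotheses (mW : measurable_fun setT W) (mW' : measurable_fun setT W').
Hypotheses (lambda0 : 0 < lambda) (Li : Rintegrable L) (Qi : Rintegrable Q)
  (LDi : Rintegrable (fun t => L t * D t))
  (aLDi : Rintegrable (fun t => `|L t| * D t))
  (W1i : Rintegrable W1) (W2i : Rintegrable W2).
Hypothesis regression : forall (h : R -> R) (M : R), measurable_fun setT h ->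
  (forall x, `|h x| <= M) ->
  \int[P]_t (L t * h (W t)) = lambda * \int[P]_t ((W t + Q t) * h (W t)).
Hypothesis condW1 : forall (h : R -> R) (M : R), measurable_fun setT h ->
  (forall x, `|h x| <= M) ->
  \int[P]_t ((L t * D t) * h (W t)) = \int[P]_t (W1 t * h (W t)).
Hypothesis condW2 : forall (h : R -> R) (M : R), measurable_fun setT h ->
  (forall x, `|h x| <= M) ->
  \int[P]_t ((`|L t| * D t) * h (W t)) = \int[P]_t (W2 t * h (W t)).
Hypothesis antiL : forall (h : R -> R) (M : R), measurable_fun setT h ->
  (forall x, `|h x| <= M) ->
  \int[P]_t (L t * h (W' t)) = - \int[P]_t (L t * h (W t)).
Hypothesis antiLD : forall (h : R -> R) (M : R), measurable_fun setT h ->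
  (forall x, `|h x| <= M) ->
  \int[P]_t ((`|L t| * D t) * h (W' t)) =
  - \int[P]_t ((`|L t| * D t) * h (W t)).

Lemma stein_exchangeable_bound (z : R) :
  `|fine (P (W @^-1` `]-oo, z])) - gauss_cdf z| <=
  \int[P]_t `|1 - (2 * lambda)^-1 * W1 t| + lambda^-1 * \int[P]_t `|W2 t| +
  Num.sqrt (2 * pi) / 4 * \int[P]_t `|Q t|.
Proof.
set c := Num.sqrt (2 * pi) / 4.
have mS := measurable_stein z; have mdS := measurable_dstein z.
have mk := measurable_stein_var z.
have mC (h : R -> R) (U : T -> R) : measurable_fun setT h ->
    measurable_fun setT U -> measurable_fun setT (fun t => h (U t)).
  by move=> mh mU; exact: measurableT_comp mh mU.
have Sb x : `|stein z x| <= c by rewrite ger0_norm ?stein_ge0 ?stein_le.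
have dSb := norm_dstein_le1 z; have kb := norm_stein_var_le1 z.
(* [W] carries no integrability hypothesis; this product is integrable because it is bounded. *)
have gb t : `|W t * stein z (W t)| <= 1.
  have := mulr_stein_le z (W t); have := mulr_stein_ge z (W t).
  have := gauss_cdf_ge0 z; have := gauss_cdf_le1 z.
  by rewrite ler_norml => *; apply/andP; split; lra.
have mul_i f (h : R -> R) (U : T -> R) (M : R) : Rintegrable f ->
    measurable_fun setT h -> measurable_fun setT U ->
    (forall x, `|h x| <= M) -> Rintegrable (fun t => f t * h (U t)).
  move=> fi mh mU hM; apply: (Rintegrable_mul_bounded fi (mC _ _ mh mU)) => t.
  exact: hM.
have LSi := mul_i _ _ _ _ Li mS mW Sb; have LS'i := mul_i _ _ _ _ Li mS mW' Sb.
have QSi := mul_i _ _ _ _ Qi mS mW Sb.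
have LDdi := mul_i _ _ _ _ LDi mdS mW dSb.
have aLDki := mul_i _ _ _ _ aLDi mk mW kb.
have aLDk'i := mul_i _ _ _ _ aLDi mk mW' kb.
have W1di := mul_i _ _ _ _ W1i mdS mW dSb.
have gi : Rintegrable (fun t => W t * stein z (W t)).
  by apply: Rintegrable_bounded gb; apply: measurable_funM => //; exact: mC.
have di : Rintegrable (fun t => dstein z (W t)).
  by apply: (@Rintegrable_bounded _ _ _ _ _ 1) => //; exact: mC.
have W1'i : Rintegrable (fun t => 1 - (2 * lambda)^-1 * W1 t).
  apply: RintegrableB; last exact: RintegrableZl.
  exact: finite_measure_integrable_cst.
have e1 := antiL mS Sb.
have e2 : \int[P]_t (L t * stein z (W t)) = lambda *
    (\int[P]_t (W t * stein z (W t)) + \int[P]_t (Q t * stein z (W t))).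
  rewrite (regression mS Sb) -RintegralD//; congr (_ * _).
  by apply: eq_Rintegral => t _; rewrite mulrDl.
have e3 : fine (P (W @^-1` `]-oo, z])) - gauss_cdf z =
    \int[P]_t dstein z (W t) - \int[P]_t (W t * stein z (W t)).
  have mWz : measurable (W @^-1` `]-oo, z]).
    by rewrite -[X in measurable X]setTI; exact: mW.
  rewrite -RintegralB//.
  transitivity (\int[P]_t (\1_(W @^-1` `]-oo, z]) t - gauss_cdf z)).
    rewrite RintegralB//.
    - rewrite Rintegral_cst// [X in gauss_cdf z * X](_ : _ = 1); last first.
        exact: (congr1 fine (probability_setT P)).
      rewrite mulr1; congr (_ - _).
      by rewrite /Rintegral integral_indic// setIT.
    - exact: integrable_indic.
    - exact: finite_measure_integrable_cst.
  apply: eq_Rintegral => t _; rewrite indicE /dstein.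
  rewrite (_ : (t \in _) = (W t <= z)); first by ring.
  by apply/idP/idP; rewrite inE/= in_itv.
(* The first-order Taylor error of [stein z], weighted by [L]. By [antiL], the increment of
   [stein z] contributes twice the integral of [L * stein z (W)]. *)
pose J t := L t * (D t * dstein z (W t) - (stein z (W t) - stein z (W' t))).
have JE t : J t = (L t * D t) * dstein z (W t) -
    (L t * stein z (W t) - L t * stein z (W' t)).
  by rewrite /J; ring.
have Ji : Rintegrable J.
  by rewrite (funext JE); apply: RintegrableB => //; exact: RintegrableB.
have e4 : \int[P]_t J t =
    \int[P]_t (W1 t * dstein z (W t)) - 2 * \int[P]_t (L t * stein z (W t)).
  under eq_Rintegral do rewrite JE.
  rewrite RintegralB//; last exact: RintegrableB.
  by rewrite RintegralB// (condW1 mdS dSb) e1; ring.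
(* After [stein_taylor], [antiLD] makes the [W'] term equal to the [W] term. The resulting 2 later
   cancels against [(2 * lambda)^-1]. *)
have e5 : `|\int[P]_t J t| <= 2 * \int[P]_t `|W2 t|.
  apply: (le_trans (le_normr_Rintegral measurableT Ji)).
  apply: (@le_trans _ _ (\int[P]_t ((`|L t| * D t) * stein_var z (W t) -
      (`|L t| * D t) * stein_var z (W' t)))).
    apply: le_Rintegral => //; first exact: (integrable_norm Ji).
      exact: RintegrableB.
    move=> t _; rewrite -mulrBr -mulrA normrM ler_wpM2l//.
    exact: stein_taylor.
  rewrite RintegralB// (antiLD mk kb) (condW2 mk kb) opprK.
  suff : \int[P]_t (W2 t * stein_var z (W t)) <= \int[P]_t `|W2 t| by lra.
  apply: (le_trans (ler_norm _)); rewrite -[leRHS]mul1r.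
  by apply: norm_Rintegral_mul_le => //; exact: mC.
have e6 : `|\int[P]_t dstein z (W t) -
      (2 * lambda)^-1 * \int[P]_t (W1 t * dstein z (W t))| <=
    \int[P]_t `|1 - (2 * lambda)^-1 * W1 t|.
  rewrite -[leRHS]mul1r -RintegralZl// -RintegralB//; last exact: RintegrableZl.
  rewrite (_ : \int[P]_t _ =
    \int[P]_t ((1 - (2 * lambda)^-1 * W1 t) * dstein z (W t))).
    by apply: norm_Rintegral_mul_le => //; exact: mC.
  by apply: eq_Rintegral => t _; ring.
have e7 : `|\int[P]_t (Q t * stein z (W t))| <= c * \int[P]_t `|Q t|.
  by apply: norm_Rintegral_mul_le => //; exact: mC.
rewrite e3.
have -> : \int[P]_t dstein z (W t) - \int[P]_t (W t * stein z (W t)) =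
  (\int[P]_t dstein z (W t) -
   (2 * lambda)^-1 * \int[P]_t (W1 t * dstein z (W t)))
  + (2 * lambda)^-1 * \int[P]_t J t + \int[P]_t (Q t * stein z (W t)).
  by rewrite e4 e2; field; exact: lt0r_neq0.
apply: (le_trans (ler_normD _ _)); apply: lerD => //.
apply: (le_trans (ler_normD _ _)); apply: lerD => //.
rewrite normrM ger0_norm ?invr_ge0 ?mulr_ge0 ?(ltW lambda0)//.
rewrite ler_pdivrMl ?mulr_gt0//; apply: (le_trans e5).
rewrite le_eqVlt; apply/orP; left; apply/eqP; field.
exact: lt0r_neq0.
Qed.

End stein_bound.

(** * Reduction of the vector statement to the real-valued bound *)

Lemma sigma_of_preimage {R : realType} {T : Type} (d : nat)
    (X : 'I_d -> T -> R) (i : 'I_d) (B : set R) :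
  measurable B -> sigma_of X (X i @^-1` B).
Proof.
move=> mB; apply: sub_sigma_algebra; rewrite (bigD1 i)//=; left.
by exists B => //; rewrite setTI.
Qed.

Theorem theorem1p4 (dT : measure_display) (T : measurableType dT)
  (R : realType) (P : probability T R) (d : nat) (hd : (0 < d)%N)
  (X X' Rv : 'I_d -> T -> R) (lambda : R) (Lambda : 'M[R]_d)
  (W1 W2 : T -> R) :
  (forall i, measurable_fun setT (X i)) ->
  (forall i, measurable_fun setT (X' i)) ->
  exchangeable_pair P X X' ->
  0 < lambda < 1 ->
  Lambda \in unitmx ->
  (forall i : 'I_d, cond_exp_version P (sigma_of X)
     (fun t => X i t - X' i t)
     (fun t => lambda * (\sum_j Lambda i j * X j t) + lambda * Rv i t)) ->
  let i1 : 'I_d := Ordinal hd in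
  let ell := fun j => invmx Lambda i1 j in
  let D := fun j t => X j t - X' j t in
  let ellD := fun t => \sum_j ell j * D j t in
  let ellR := fun t => \sum_j ell j * Rv j t in
  cond_exp_version P (sigma_of X) (fun t => ellD t * D i1 t) W1 ->
  cond_exp_version P (sigma_of X) (fun t => `|ellD t| * D i1 t) W2 ->
  (kolmogorov_dist (distr_fun P (X i1)) std_normal_cdf <=
     (\int[P]_t (`|1 - (2 * lambda)^-1 * W1 t|)%:E)
     + (lambda^-1)%:E * (\int[P]_t (`|W2 t|)%:E)
     + (Num.sqrt (2 * pi) / 4)%:E * (\int[P]_t (`|ellR t|)%:E))%E.
Proof.
move=> mX mX' exch /andP[l0 _] Lu reg i1 ell D ellD ellR ce1 ce2.
have c0 : 0 < Num.sqrt (2 * pi) / 4 :> R by rewrite divr_gt0 ?sqrt2pi_gt0.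
(* Being nonnegative, these terms are not [-oo], so an infinite last term makes the whole bound
   [+oo]. *)
have sum0 : (0 <= \int[P]_t (`|1 - (2 * lambda)^-1 * W1 t|)%:E
     + (lambda^-1)%:E * (\int[P]_t (`|W2 t|)%:E))%E.
  rewrite adde_ge0 ?mule_ge0 ?integral_ge0//.
  by rewrite lee_fin invr_ge0 ltW.
have [Qfin|] := ltP (\int[P]_t (`|ellR t|)%:E)%E +oo%E; last first.
  rewrite leye_eq => /eqP ->; rewrite gt0_muley ?lte_fin// addey ?leey//.
  by apply: contraTneq sum0 => ->.
pose V j t := lambda * (\sum_k Lambda j k * X k t) + lambda * Rv j t.
have Vi j : P.-integrable setT (EFin \o V j) by have [] := reg j.
have Di j : P.-integrable setT (EFin \o D j) by have [] := reg j.
(* Pairing the regression with the first row of the inverse of [Lambda] isolates the first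
   component. *)
have sumV t : \sum_j ell j * V j t = lambda * (X i1 t + ellR t).
  rewrite /V /ellR; under eq_bigr do rewrite -mulrDr mulrCA.
  rewrite -mulr_sumr; congr (_ * _).
  under eq_bigr do rewrite mulrDr; rewrite big_split/=; congr (_ + _).
  under eq_bigr do rewrite mulr_sumr; rewrite exchange_big/=.
  have ellL k : \sum_j ell j * Lambda j k = (i1 == k)%:R.
    by have := mulVmx Lu => /matrixP/(_ i1 k); rewrite !mxE => <-.
  transitivity (\sum_k (i1 == k)%:R * X k t).
    apply: eq_bigr => k _; rewrite -ellL mulr_suml.
    by apply: eq_bigr => j _; rewrite mulrA.
  rewrite (bigD1 i1)// eqxx mul1r big1 => [|k]; first exact: addr0.
  by rewrite eq_sym => /negbTE ->; rewrite mul0r.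
have sum_i (F : 'I_d -> T -> R) :
    (forall j, P.-integrable setT (EFin \o F j)) ->
    P.-integrable setT (EFin \o (fun t => \sum_j ell j * F j t)).
  move=> Fi; rewrite (_ : _ \o _ =
    fun t => (\sum_j (ell j * F j t)%:E)%E); last first.
    by apply/funext => t /=; rewrite sumEFin.
  by apply: integrable_sum => // j _; exact: (RintegrableZl _ (Fi j)).
have Li : P.-integrable setT (EFin \o ellD) by exact: sum_i.
(* Nothing is assumed on the measurability of [Rv]; that of [ellR] is recovered by solving [sumV]
   for it. *)
have mQ : measurable_fun setT ellR.
  rewrite (_ : ellR =
    fun t => lambda^-1 * (\sum_j ell j * V j t) - X i1 t); last first.
    by apply/funext => t; rewrite sumV mulKf ?lt0r_neq0//; ring.
  apply: measurable_funB => //; apply: measurable_funM => //.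
  exact: (Rintegrable_measurable (sum_i _ Vi)).
have Qi : P.-integrable setT (EFin \o ellR).
  by apply/integrableP; split => //; exact/measurable_EFinP.
have [LDi W1i _ _] := ce1; have [aLDi W2i _ _] := ce2.
have cond Y W (h : R -> R) (M : R) : cond_exp_version P (sigma_of X) Y W ->
    measurable_fun setT h -> (forall x, `|h x| <= M) ->
    \int[P]_t (Y t * h (X i1 t)) = \int[P]_t (W t * h (X i1 t)).
  move=> YW mh hM.
  apply: (cond_exp_mul_bounded (h := h \o X i1) (M := M) YW).
  - exact: measurableT_comp.
  - move=> B mB; rewrite comp_preimage; apply: sigma_of_preimage.
    by rewrite -[X in measurable X]setTI; exact: mh.
  - by move=> t; exact: hM.
have regr (h : R -> R) (M : R) : measurable_fun setT h ->
    (forall x, `|h x| <= M) ->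
    \int[P]_t (ellD t * h (X i1 t)) =
    lambda * \int[P]_t ((X i1 t + ellR t) * h (X i1 t)).
  move=> mh hM.
  (* Integrability is known for each whole right-hand side [V j], not for its two terms, so sums are
     split over [j] only and [sumV] is applied under the integral. *)
  have sumE (F : 'I_d -> T -> R) :
    (forall j, P.-integrable setT (EFin \o F j)) ->
    \int[P]_t ((\sum_j ell j * F j t) * h (X i1 t)) =
    \sum_j ell j * \int[P]_t (F j t * h (X i1 t)).
    move=> Fi; have Fhi j : P.-integrable setT
        (EFin \o (fun t => F j t * h (X i1 t))).
      apply: (Rintegrable_mul_bounded (Fi j) (h := h \o X i1) (M := M)).
        exact: measurableT_comp.
      by move=> t; exact: hM.
    under eq_Rintegral do rewrite mulr_suml.
    rewrite Rintegral_sum//.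
      apply: eq_bigr => j _; under eq_Rintegral do rewrite -mulrA.
      by rewrite RintegralZl.
    move=> j; apply: eq_integrable (RintegrableZl (ell j) (Fhi j)) => // t _ /=.
    by rewrite mulrA.
  rewrite sumE//; transitivity (\sum_j ell j * \int[P]_t (V j t * h (X i1 t))).
    by apply: eq_bigr => j _; rewrite (cond _ _ _ _ (reg j) mh hM).
  rewrite -sumE//; under eq_Rintegral do rewrite sumV -mulrA.
  rewrite RintegralZl//.
  apply: (Rintegrable_mul_bounded (f := fun t => X i1 t + ellR t)
    (h := h \o X i1) (M := M)).
  - apply: eq_integrable (RintegrableZl lambda^-1 (sum_i _ Vi)) => // t _ /=.
    by rewrite sumV mulKf ?lt0r_neq0.
  - exact: measurableT_comp.
  - by move=> t; exact: hM.
have mt (j : 'I_d) : measurable_fun setT (fun x : d.-tuple R => tnth x j).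
  exact: measurable_tnth.
have mD (j : 'I_d) : measurable_fun setT
    (fun p : d.-tuple R * d.-tuple R => tnth p.1 j - tnth p.2 j).
  by apply: measurable_funB; exact: (measurableT_comp (mt j)).
(* [ellD] and [|ellD| D_1] as antisymmetric functions [A1] and [A2] of the pair of vectors. *)
pose A1 (p : d.-tuple R * d.-tuple R) :=
  \sum_j ell j * (tnth p.1 j - tnth p.2 j).
have mA1 : measurable_fun setT A1.
  by apply: measurable_sum => j; apply: measurable_funM => //; exact: mD.
have A1N x y : A1 (y, x) = - A1 (x, y).
  by rewrite /A1 -sumrN; apply: eq_bigr => j _ /=; ring.
pose A2 p := `|A1 p| * (tnth p.1 i1 - tnth p.2 i1).
have mA2 : measurable_fun setT A2.
  by apply: measurable_funM => //; exact: measurableT_comp.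
have A2N x y : A2 (y, x) = - A2 (x, y).
  by rewrite /A2 A1N normrN/=; ring.
have A1E t : A1 (vec_of X t, vec_of X' t) = ellD t.
  by apply: eq_bigr => j _; rewrite !tnth_mktuple.
have A2E t : A2 (vec_of X t, vec_of X' t) = `|ellD t| * D i1 t.
  by rewrite /A2 A1E !tnth_mktuple.
have anti (A : d.-tuple R * d.-tuple R -> R) (f : T -> R) (h : R -> R) (M : R) :
    measurable_fun setT A -> (forall x y, A (y, x) = - A (x, y)) ->
    (forall t, A (vec_of X t, vec_of X' t) = f t) ->
    P.-integrable setT (EFin \o f) ->
    measurable_fun setT h -> (forall x, `|h x| <= M) ->
    \int[P]_t (f t * h (X' i1 t)) = - \int[P]_t (f t * h (X i1 t)).
  move=> mA AN AE fi mh hM; rewrite -(funext AE) in fi.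
  have mh1 : measurable_fun setT (fun x : d.-tuple R => h (tnth x i1)).
    exact: (measurableT_comp mh).
  have hM1 (x : d.-tuple R) : `|h (tnth x i1)| <= M by exact: hM.
  have := exchangeable_antisymmetric mX mX' exch mA AN fi mh1 hM1.
  under eq_Rintegral do rewrite AE tnth_mktuple.
  move=> ->; congr (- _).
  by apply: eq_Rintegral => t _; rewrite AE tnth_mktuple.
(* With [z] fixed all terms are finite, and the extended inequality becomes a real one. *)
apply: ge_ereal_sup => _ [z _ <-].
have W1'i : P.-integrable setT (EFin \o (fun t => 1 - (2 * lambda)^-1 * W1 t)).
  apply: RintegrableB; last exact: RintegrableZl.
  exact: finite_measure_integrable_cst.
have fineN (f : T -> R) : P.-integrable setT (EFin \o f) ->
    (\int[P]_t (`|f t|)%:E)%E = (\int[P]_t `|f t|)%:E.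
  move=> fi; rewrite fineK//; apply: integrable_fin_num => //.
  exact: (integrable_norm fi).
rewrite !fineN// std_normal_cdfE /distr_fun.
rewrite -[P _]fineK ?fin_num_measure//; last first.
  by rewrite -[X in measurable X]setTI; exact: mX.
rewrite -EFinB -!EFinM -!EFinD lee_fin.
apply: (@stein_exchangeable_bound _ _ _ P (X i1) (X' i1) ellD) => //.
- by move=> h M mh hM; exact: (cond _ _ _ _ ce1 mh hM).
- by move=> h M mh hM; exact: (cond _ _ _ _ ce2 mh hM).
- by move=> h M mh hM; exact: (anti A1 _ _ M).
- by move=> h M mh hM; exact: (anti A2 _ _ M).
Qed.
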